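(* Let $p$ be a prime, $q\in U^{(1)}$, $n\in\mathbb{N}$ ($n\geq 1$), and $m_0=v_p(q-1)$. If $p=3$ and $q\in U^{(1)}-U^{(2)}$, let $v_0$ be the smallest nonzero value of $v_3(z(z-1))$ over all modular fixed points $z\in\mathbb{Z}_3$ of $[\iota_q]_{3^n}$. If $q\equiv 1\pmod{p^n}$, then every point of $\mathbb{Z}_p$ is a modular fixed point of $[\iota_q]_{p^n}$. If $q\not\equiv 1\pmod{p^n}$, then the number of modular fixed points of $[\iota_q]_{p^n}$, counted modulo $p^n\mathbb{Z}_p$, is $$\begin{cases} 2p^{m_0} & \text{if $p$ is odd, and $p\neq 3$ or $q\in U^{(2)}$},\\ 2^{m_0} & \text{if } p=2,\\ 2\cdot 3^{v_0+1}+3 & \text{if $p=3$, $q\in U^{(1)}-U^{(2)}$, and $v_0<\frac{n-1}{2}$},\\ 3^{n-\lfloor n/2\rfloor}+3 & \text{if $p=3$, $q\in U^{(1)}-U^{(2)}$, and $v_0\geq\frac{n-1}{2}$.}\end{cases}$$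
   Context: $\mathbb{Z}_p$ is the ring of $p$-adic integers with additive valuation $v_p$, and $U^{(m)}=1+p^m\mathbb{Z}_p$. For $q\in U^{(1)}$, $\iota_q:\mathbb{Z}_p\to\mathbb{Z}_p$ is the unique continuous function with $\iota_q(k)=1+q+\cdots+q^{k-1}$ for all integers $k\ge 0$; thus $\iota_q(z)=(q^z-1)/(q-1)$ for $q\ne1$ and $\iota_1(z)=z$. $[\iota_q]_{p^n}$ is its reduction modulo $p^n$, and $z\in\mathbb{Z}_p$ is a modular fixed point of $[\iota_q]_{p^n}$ if $\iota_q(z)\equiv z\pmod{p^n}$; this property depends only on $z$ modulo $p^n$. *)

(* Defs.v *)
From HB Require Import structures.
From mathcomp Require Import all_boot all_order all_algebra.
From mathcomp Require Import mathcomp_extra boolp classical_sets functions.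
From mathcomp Require Import cardinality reals constructive_ereal topology.

Set Implicit Arguments.
Unset Strict Implicit.
Unset Printing Implicit Defensive.

Import Order.TTheory GRing.Theory Num.Theory.
Local Open Scope classical_set_scope.
Local Open Scope card_scope.
Local Open Scope ring_scope.

(** [padic p] is the inverse limit of the rings Z / p^n: an element is the
   sequence of its residues [zres x n], each taken in [0, p^n).  No hypothesis
   on [p] is needed to define the ring (for p = 1 it is trivial, hence only a
   [comPzRingType]). *)

Definition coherent (p : nat) (x : nat -> int) : Prop :=
  forall n, x n = (x n.+1 %% (p ^ n)%N%:Z)%Z.

Record padic (p : nat) := MkPadic {
  zres : nat -> int;
  zres_coherent : `[< coherent p zres >] }.

HB.instance Definition _ (p : nat) := [isSub for @zres p].
HB.instance Definition _ (p : nat) := [Choice of padic p by <:].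

Section PadicRing.
Variable p : nat.
Implicit Types (x y z : padic p) (f g : nat -> int) (n : nat).

Definition precoherent f : Prop :=
  forall n, ((p ^ n)%N%:Z %| f n.+1 - f n)%Z.

Lemma padic_of_subproof f (hf : precoherent f) :
  `[< coherent p (fun n => (f n %% (p ^ n)%N%:Z)%Z) >].
Proof.
apply/asboolP => n; apply/eqP; rewrite eqz_mod_dvd.
have h1 : ((p ^ n)%N%:Z %| f n.+1 - (f n.+1 %% (p ^ n.+1)%N%:Z)%Z)%Z.
  apply: (@dvdz_trans (p ^ n.+1)%N); first by rewrite dvdzE !absz_nat dvdn_exp2l.
  by rewrite -eqz_mod_dvd modz_mod.
have e (a b c : int) : a - b = (c - b) - (c - a).
  by rewrite opprB [RHS]addrC subrKA.
by rewrite (e _ _ (f n.+1)) rpredB.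
Qed.

Definition padic_of f (hf : precoherent f) : padic p :=
  MkPadic (padic_of_subproof hf).

Lemma zres_mod x n : (zres x n %% (p ^ n)%N%:Z)%Z = zres x n.
Proof. by have /asboolP/(_ n) -> := zres_coherent x; rewrite modz_mod. Qed.

Lemma zres_precoherent x : precoherent (zres x).
Proof.
move=> n; rewrite -eqz_mod_dvd zres_mod.
by have /asboolP/(_ n) -> := zres_coherent x.
Qed.

Lemma padicP x y :
  (forall n, (zres x n = zres y n %[mod (p ^ n)%N])%Z) -> x = y.
Proof.
move=> h; apply: val_inj; apply: funext => n /=.
by have := h n; rewrite !zres_mod.
Qed.

Lemma precoherentD f g : precoherent f -> precoherent g ->
  precoherent (fun n => f n + g n).
Proof. by move=> hf hg n; rewrite opprD addrACA; apply: rpredD. Qed.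

Lemma precoherentN f : precoherent f -> precoherent (fun n => - f n).
Proof. by move=> hf n; rewrite -opprD rpredN. Qed.

Lemma precoherentM f g : precoherent f -> precoherent g ->
  precoherent (fun n => f n * g n).
Proof.
move=> hf hg n.
have -> : f n.+1 * g n.+1 - f n * g n =
    (f n.+1 - f n) * g n.+1 + f n * (g n.+1 - g n).
  by rewrite mulrBl mulrBr subrKA.
by apply: rpredD; [exact: dvdz_mulr | exact: dvdz_mull].
Qed.

Lemma precoherentC (k : int) : precoherent (fun=> k).
Proof. by move=> n; rewrite subrr dvdz0. Qed.

Definition padic_zero : padic p := padic_of (precoherentC 0).
Definition padic_one : padic p := padic_of (precoherentC 1).
Definition padic_opp x : padic p := padic_of (precoherentN (zres_precoherent x)).
Definition padic_add x y : padic p :=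
  padic_of (precoherentD (zres_precoherent x) (zres_precoherent y)).
Definition padic_mul x y : padic p :=
  padic_of (precoherentM (zres_precoherent x) (zres_precoherent y)).

Lemma padic_addA : associative padic_add.
Proof. by move=> x y z; apply: padicP => n /=; rewrite !modz_mod modzDml modzDmr addrA. Qed.
Lemma padic_addC : commutative padic_add.
Proof. by move=> x y; apply: padicP => n /=; rewrite addrC. Qed.
Lemma padic_add0 : left_id padic_zero padic_add.
Proof. by move=> x; apply: padicP => n /=; rewrite !modz_mod modzDml add0r. Qed.
Lemma padic_addN : left_inverse padic_zero padic_opp padic_add.
Proof. by move=> x; apply: padicP => n /=; rewrite !modz_mod modzDml addNr. Qed.

HB.instance Definition _ := GRing.isZmodule.Build (padic p)
  padic_addA padic_addC padic_add0 padic_addN.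

Lemma padic_mulA : associative padic_mul.
Proof. by move=> x y z; apply: padicP => n /=; rewrite !modz_mod modzMml modzMmr mulrA. Qed.
Lemma padic_mulC : commutative padic_mul.
Proof. by move=> x y; apply: padicP => n /=; rewrite mulrC. Qed.
Lemma padic_mul1 : left_id padic_one padic_mul.
Proof. by move=> x; apply: padicP => n /=; rewrite !modz_mod modzMml mul1r. Qed.
Lemma padic_mulDl : left_distributive padic_mul padic_add.
Proof.
by move=> x y z; apply: padicP => n /=; rewrite !modz_mod modzMml modzDml modzDmr mulrDl.
Qed.

HB.instance Definition _ := GRing.Zmodule_isComPzRing.Build (padic p)
  padic_mulA padic_mulC padic_mul1 padic_mulDl.

Definition pideal n : set (padic p) := range (fun t => p%:R ^+ n * t).

Definition pcong n x y : Prop := pideal n (x - y).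

Definition pclass n x : set (padic p) := [set y | pcong n y x].

Lemma pcong_refl n x : pcong n x x.
Proof. by exists 0 => //; rewrite mulr0 subrr. Qed.

Lemma pcong_sym n x y : pcong n x y -> pcong n y x.
Proof. by case=> t _ e; exists (- t) => //; rewrite mulrN e opprB. Qed.

Lemma pcong_trans n x y z : pcong n x y -> pcong n y z -> pcong n x z.
Proof.
case=> t _ e [u _ e']; exists (t + u) => //.
by rewrite mulrDr e e' addrA addrNK.
Qed.

Lemma pcongW m n x y : (m <= n)%N -> pcong n x y -> pcong m x y.
Proof.
move=> mn [t _ e]; exists (p%:R ^+ (n - m) * t) => //.
by rewrite mulrA -exprD subnKC.
Qed.

Definition padic_nbhs x : set_system (padic p) :=
  [set A | exists n, pclass n x `<=` A].

HB.instance Definition _ := hasNbhs.Build (padic p) padic_nbhs.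

Lemma padic_nbhs_filter x : ProperFilter (nbhs x).
Proof.
apply: Build_ProperFilter_ex => [A [n nA]|].
  by exists x; apply: nA; exact: pcong_refl.
split=> [|A B [n nA] [m mB]|A B AB [n nA]].
- by exists 0%N.
- exists (maxn n m) => y xy; split.
    by apply: nA; apply: pcongW xy; exact: leq_maxl.
  by apply: mB; apply: pcongW xy; exact: leq_maxr.
- by exists n => y /nA /AB.
Qed.

Lemma padic_nbhs_singleton x (A : set (padic p)) : nbhs x A -> A x.
Proof. by case=> n; apply; exact: pcong_refl. Qed.

Lemma padic_nbhs_nbhs x (A : set (padic p)) : nbhs x A -> nbhs x (nbhs^~ A).
Proof.
case=> n nA; exists n => y xy; exists n => z yz.
by apply: nA; exact: pcong_trans yz xy.
Qed.

HB.instance Definition _ := Nbhs_isNbhsTopological.Build (padic p)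
  padic_nbhs_filter padic_nbhs_singleton padic_nbhs_nbhs.

End PadicRing.

(** The additive valuation v_p, with v_p(0) = +oo: for x <> 0, the greatest n
   such that x is in p^n Z_p, i.e. the least n with x not in p^(n+1) Z_p;
   see [vpP]. *)
Definition vp (p : nat) (x : padic p) : \bar int :=
  if pselect (exists n, ~~ `[< pideal n.+1 x >]) is left h
  then (ex_minn h)%:Z%:E else +oo%E.

(* U^(m) *)
Definition principal_units (p m : nat) : set (padic p) := range (fun t => 1 + p%:R ^+ m * t).
Arguments principal_units : clear implicits.

Definition is_qiota (p : nat) (q : padic p) (f : padic p -> padic p) : Prop :=
  continuous f /\ forall k : nat, f k%:R = \sum_(i < k) q ^+ i.

(* For q in U^(1) there is exactly one such function: see [qiotaP] and
   [is_qiota_uniq]. *)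
Definition qiota (p : nat) (q : padic p) : padic p -> padic p :=
  xget (fun=> 0) (is_qiota q).

Definition modfix (p : nat) (q : padic p) (n : nat) : set (padic p) :=
  [set z | pcong n (qiota q z) z].

Definition modfix_classes (p : nat) (q : padic p) (n : nat) :
    set (set (padic p)) :=
  pclass n @` modfix q n.

(* The value +oo (z = 0 or 1) is never the smallest one when n >= 1: see
   [is_least_value_ex]. *)
Definition is_least_value (p : nat) (q : padic p) (n : nat) (v : \bar int) :
    Prop :=
  let S := [set w | w <> 0%E /\ exists2 z, modfix q n z & w = vp (z * (z - 1))] in
  S v /\ forall w, S w -> (v <= w)%E.

Section PadicTheory.
Variable p : nat.
Hypothesis p_gt0 : (0 < p)%N.
Implicit Types (x y z q : padic p) (n m : nat).

Lemma zres_nat k n : zres (k%:R : padic p) n = (k%:Z %% (p ^ n)%N%:Z)%Z.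
Proof.
elim: k => [|k IH]; first by rewrite /= mod0z.
have -> : (k.+1%:R : padic p) = padic_add k%:R (padic_one p) by rewrite -natr1.
by rewrite /= IH modzDml modzDmr -PoszD addn1.
Qed.

Lemma zres_leq x m n : (m <= n)%N -> zres x m = (zres x n %% (p ^ m)%N%:Z)%Z.
Proof.
elim: n => [|n IH]; first by rewrite leqn0 => /eqP->; rewrite zres_mod.
rewrite leq_eqVlt => /orP[/eqP->|]; first by rewrite zres_mod.
rewrite ltnS => mn; rewrite (IH mn); apply/eqP; rewrite eq_sym eqz_mod_dvd.
apply: (@dvdz_trans (p ^ n)%N); first by rewrite dvdzE !absz_nat dvdn_exp2l.
exact: zres_precoherent.
Qed.

Lemma pidealP n z : pideal n z <-> zres z n = 0.
Proof.
have pn0 : ((p ^ n)%N%:Z != 0 :> int) by rewrite eqz_nat -lt0n expn_gt0 p_gt0.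
split=> [[t _ <-]|z0].
  by rewrite -natrX /= zres_nat modzz mul0r mod0z.
have zd k : ((p ^ n)%N%:Z %| zres z (n + k))%Z.
  by apply/dvdz_mod0P; rewrite -zres_leq ?leq_addr.
pose t k := (zres z (n + k) %/ (p ^ n)%N%:Z)%Z.
have tE k : (p ^ n)%N%:Z * t k = zres z (n + k) by rewrite mulrC divzK.
have ht : precoherent p t.
  move=> k; rewrite -(dvdz_mul2l pn0) mulrBr !tE -PoszM -expnD addnS.
  exact: zres_precoherent.
exists (padic_of ht) => //; apply: padicP => k.
rewrite -natrX /= zres_nat modz_mod modzMml modzMmr tE.
by rewrite [in RHS](zres_leq z (leq_addl n k)) modz_mod.
Qed.

Lemma pcongP n x y : pcong n x y <-> zres x n = zres y n.
Proof.
rewrite /pcong; split=> [/pidealP|e]; last first.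
  by apply/pidealP => /=; rewrite modzDmr e subrr mod0z.
rewrite /= modzDmr => /dvdz_mod0P; rewrite -eqz_mod_dvd => /eqP.
by rewrite !zres_mod.
Qed.

Lemma padic_separated x y : (forall n, pcong n x y) -> x = y.
Proof. by move=> h; apply: padicP => n; have /pcongP-> := h n. Qed.

Lemma zres_ge0 x n : 0 <= zres x n.
Proof. by rewrite -zres_mod modz_ge0 // eqz_nat -lt0n expn_gt0 p_gt0. Qed.

Lemma pcong_res n x : pcong n x (`|zres x n|%N)%:R.
Proof. by apply/pcongP; rewrite zres_nat gez0_abs ?zres_ge0 // zres_mod. Qed.

Lemma is_qiota_uniq q (f g : padic p -> padic p) :
  is_qiota q f -> is_qiota q g -> f = g.
Proof.
move=> [fc fN] [gc gN]; apply: funext => z; apply: padic_separated => n.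
have [a fa] : nbhs z (f @^-1` pclass n (f z)) by apply: fc; exists n.
have [b gb] : nbhs z (g @^-1` pclass n (g z)) by apply: gc; exists n.
set k := (`|zres z (maxn a b)|%N).
have kz : pcong (maxn a b) k%:R z by apply/pcong_sym/pcong_res.
have /= h1 := fa _ (pcongW (leq_maxl a b) kz).
have /= h2 := gb _ (pcongW (leq_maxr a b) kz).
by apply: pcong_trans h2; rewrite gN -fN; exact: pcong_sym.
Qed.

Let G (Q : int) k : int := \sum_(i < k) Q ^+ i.

Lemma geo_addn (Q : int) a b : G Q (a + b) = G Q a + Q ^+ a * G Q b.
Proof.
rewrite /G big_split_ord /= mulr_sumr; congr (_ + _).
by apply: eq_bigr => i _; rewrite exprD.
Qed.

Lemma geo_muln (Q : int) a b : G Q (a * b) = G Q a * G (Q ^+ a) b.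
Proof.
elim: b => [|b IH]; first by rewrite muln0 /G !big_ord0 mulr0.
rewrite mulnS addnC geo_addn IH /G big_ord_recr /= mulrDr exprM.
by congr (_ + _); rewrite mulrC.
Qed.

Lemma geo_dvd (Q : int) n :
  (p%:Z %| Q - 1)%Z -> ((p ^ n)%N%:Z %| G Q (p ^ n))%Z.
Proof.
move=> Q1; have h (R : int) k : (p%:Z %| R - 1)%Z -> (p%:Z %| R ^+ k - 1)%Z.
  by move=> R1; rewrite subrX1; exact: dvdz_mulr.
elim: n => [|n IH]; first exact: dvd1z.
rewrite expnSr geo_muln PoszM; apply: dvdz_mul => //.
rewrite -[X in (_ %| X)%Z](subrK p%:Z); apply: rpredD; last exact: dvdzz.
have -> : p%:Z = \sum_(i < p) 1 :> int by rewrite sumr_const card_ord natz.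
rewrite /G -sumrB sumr_const card_ord natz; apply: rpred_sum => i _.
by apply/h/h.
Qed.

Lemma geo_mod (Q : int) n a b : (p%:Z %| Q - 1)%Z -> a = b %[mod p ^ n] ->
  ((p ^ n)%N%:Z %| G Q a - G Q b)%Z.
Proof.
move=> Q1; wlog ba : a b / (b <= a)%N => [hw|] e.
  case: (leqP b a) => [/hw->//|/ltnW /hw]; rewrite -rpredN opprB; exact.
have /dvdnP[c ec] : (p ^ n %| a - b)%N by rewrite -eqn_mod_dvd //; apply/eqP.
rewrite -(subnKC ba) ec mulnC geo_addn addrC addrA addNr add0r.
by apply: dvdz_mull; rewrite geo_muln; apply: dvdz_mulr; exact: geo_dvd.
Qed.

Lemma zres_principal q n : principal_units p 1 q -> (p%:Z %| zres q n.+1 - 1)%Z.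
Proof.
case=> s _ qE; have : zres q 1 = zres (1 : padic p) 1.
  by apply/pcongP; exists s => //; rewrite -qE addrC addKr.
rewrite (zres_leq q (ltn0Sn n)) /= expn1 => /eqP.
by rewrite eqz_mod_dvd.
Qed.

Lemma zresX q k n : zres (q ^+ k) n = (zres q n ^+ k %% (p ^ n)%N%:Z)%Z.
Proof.
elim: k => [|k IH]; first by rewrite expr0.
by rewrite exprS /= IH modzMmr -exprS.
Qed.

Lemma zres_geo q k n :
  zres (\sum_(i < k) q ^+ i) n = (G (zres q n) k %% (p ^ n)%N%:Z)%Z.
Proof.
elim: k => [|k IH]; first by rewrite /G !big_ord0.
by rewrite /G !big_ord_recr /= IH zresX modzDml modzDmr.
Qed.

Lemma zres_geo_mod q n a b : principal_units p 1 q -> a = b %[mod p ^ n] ->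
  zres (\sum_(i < a) q ^+ i) n = zres (\sum_(i < b) q ^+ i) n.
Proof.
move=> qU; case: n => [|n] ab; first by rewrite !zres_geo expn0 !modz1.
rewrite !zres_geo; apply/eqP; rewrite eqz_mod_dvd; apply: geo_mod => //.
exact: zres_principal.
Qed.

Lemma is_qiota_ex q : principal_units p 1 q -> exists f, is_qiota q f.
Proof.
move=> qU.
pose S k : padic p := \sum_(i < k) q ^+ i.
have Smod n a b : a = b %[mod p ^ n] -> zres (S a) n = zres (S b) n.
  exact: zres_geo_mod.
have absmod z n : `|zres z n.+1|%N = `|zres z n|%N %[mod p ^ n].
  have /eqP := zres_leq z (leqnSn n); rewrite -{1}(zres_mod z n).
  rewrite -{1}(gez0_abs (zres_ge0 z n)) -{1}(gez0_abs (zres_ge0 z n.+1)) !modz_nat eqz_nat.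
  by move/eqP.
pose u z n := zres (S `|zres z n|%N) n.
have hu z : precoherent p (u z).
  move=> n; rewrite /u -eqz_mod_dvd zres_mod -(Smod _ _ _ (absmod z n)).
  by apply/eqP; rewrite -zres_leq.
exists (fun z => padic_of (hu z)); split=> [z A [n nA]|k].
  exists n => z' zz'; apply: nA; apply/pcongP => /=.
  by rewrite /u; have /pcongP-> := zz'.
apply: padicP => n /=; rewrite modz_mod /u !zres_mod.
by apply: Smod; rewrite zres_nat modz_nat absz_nat modn_mod.
Qed.

Lemma qiotaP q : principal_units p 1 q -> is_qiota q (qiota q).
Proof. by move=> /is_qiota_ex[f hf]; apply: (xgetPex _ (ex_intro _ f hf)). Qed.

Lemma vp0 : vp (0 : padic p) = +oo%E.
Proof.
rewrite /vp; case: pselect => // -[n /asboolPn[]].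
by exists 0 => //; rewrite mulr0.
Qed.

Lemma vpP x n : vp x = n%:Z%:E <-> pideal n x /\ ~ pideal n.+1 x.
Proof.
have W a b : (a <= b)%N -> pideal b x -> pideal a x.
  by move=> ab xb; rewrite -[x]subr0; apply: pcongW ab _; rewrite /pcong subr0.
rewrite /vp; case: pselect => [h|h]; last first.
  by split=> // -[_ nx]; case: h; exists n; apply/asboolPn.
case: ex_minnP => m /asboolPn mx mmin; split=> [[<-]|[nx nx']].
  split=> //; case: (m) mmin => [|k] mmin.
    by exists x => //; rewrite expr0 mul1r.
  by apply: contrapT => /asboolPn /mmin; rewrite ltnn.
congr (_%:Z%:E); apply/eqP; rewrite eqn_leq; apply/andP; split.
  by apply: mmin; apply/asboolPn.
by rewrite leqNgt; apply/negP => mn; apply: mx; exact: W nx.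
Qed.

Lemma vp_fin x : x != 0 -> exists n, vp x = n%:Z%:E.
Proof.
move=> x0; rewrite /vp; case: pselect => [h|h]; first by exists (ex_minn h).
case/eqP: x0; apply: padic_separated => -[|n]; first by exists x; rewrite // expr0 mul1r subr0.
by rewrite /pcong subr0; apply: contrapT => nx; apply: h; exists n; apply/asboolPn.
Qed.

End PadicTheory.

Lemma is_least_value_uniq (p : nat) (q : padic p) (n : nat) (v w : \bar int) :
  is_least_value q n v -> is_least_value q n w -> v = w.
Proof.
by move=> [vS vmin] [wS wmin]; apply/eqP; rewrite eq_le vmin // wmin.
Qed.

Lemma is_least_value_ex (p : nat) (q : padic p) (n : nat) :
  prime p -> (0 < n)%N -> principal_units p 1 q ->
  exists v : nat, is_least_value q n v%:Z%:E.
Proof.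
move=> pp n0 qU; have p0 := prime_gt0 pp.
have [_ iotaN] := qiotaP p0 qU.
pose S (v : nat) := (v != 0%N) && `[< exists2 z, modfix q n z & vp (z * (z - 1)) = v%:Z%:E >].
have Sex : exists v, S v.
  pose z : padic p := (p ^ n)%:R.
  have pn1 : (1 < p ^ n)%N by rewrite -(exp1n n) ltn_exp2r // prime_gt1.
  have zz : z * (z - 1) = (p ^ n * (p ^ n).-1)%:R.
    by rewrite natrM -subn1 natrB // ltnW.
  have zn0 : z * (z - 1) != 0.
    apply/eqP => e; set M := (p ^ n * (p ^ n).-1)%N in zz.
    have := zres_nat p M M; rewrite -zz e /= mod0z modz_nat modn_small.
      case=> M0; have : (0 < M)%N by rewrite muln_gt0 ltnW //= -subn1 subn_gt0.
      by rewrite -M0.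
    by rewrite ltn_expl ?prime_gt1.
  have [v ev] := vp_fin p0 zn0; exists v; apply/andP; split.
    apply/eqP => v0; move: ev; rewrite v0 => /vpP[_]; apply.
    exists (p%:R ^+ n.-1 * (z - 1)) => //.
    by rewrite mulrA -exprD add1n prednK // -natrX.
  apply/asboolP; exists z => //; rewrite /modfix /= iotaN.
  apply/(pcongP p0); rewrite (@zres_geo_mod _ p0 _ _ _ 0%N) ?modnn ?mod0n //.
  by rewrite big_ord0 zres_nat modzz /= mod0z.
case: (ex_minnP Sex) => v /andP[v0 /asboolP[z zfix zv]] vmin.
exists v; split=> [|w [w0 [y yfix yv]]].
  by split; [case=> /eqP; apply/negP | exists z].
case: (eqVneq (y * (y - 1)) 0) => [y0|yn0].
  by rewrite yv y0 vp0 // leey.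
have [m em] := vp_fin p0 yn0; rewrite yv em lee_fin lez_nat; apply: vmin.
apply/andP; split; last by apply/asboolP; exists y.
by apply/eqP => m0; apply: w0; rewrite yv em m0.
Qed.

(* Main.v *)
(** With Q a residue of q and G(k) = 1 + Q + ... + Q^(k-1), one has
   G(k) - k = (Q - 1) H(k) where H(k) = G(0) + ... + G(k-1); so k is a modular
   fixed point iff p^(n-m0) divides H(k).  For r = 0 and r = 1 the function
   e(b) = H(b + r) satisfies the quadratic cocycle identity
   e(a + b) = e(a) + e(b) + Q^r G(a) G(b), hence
   e(ca) = c e(a) + Q^r G(a)^2 H_{Q^a}(c), which determines v_p(e(b)) for p | b
   as soon as v_p(e(p)) is the generic one: then v_p(e(b)) = v_p(b), or
   v_2(b) - 1 if p = 2.  This settles every case except p = 3, m0 = 1, where it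
   still holds around exactly one of the two points r = 0, 1.  Around the other
   one there is an integer L divisible by 3 such that, 3-adically to leading
   order, 2 e(b) = b (L + b); the solutions near that point cluster around 0
   and a second root -L, and v0 tells which of the two regimes v_3(L) is in. *)

Require Import Defs.
From mathcomp Require Import all_boot all_order all_algebra.
From mathcomp Require Import mathcomp_extra boolp classical_sets functions.
From mathcomp Require Import cardinality reals constructive_ereal topology.
From mathcomp Require Import ring zify.

Set Implicit Arguments.
Unset Strict Implicit.

Import Order.TTheory GRing.Theory Num.Theory.
Local Open Scope classical_set_scope.
Local Open Scope card_scope.
Local Open Scope ring_scope.

(** * Geometric sums and the cocycle identity *)

Definition geo (Q : int) (k : nat) : int := \sum_(i < k) Q ^+ i.
Definition geo2 (Q : int) (k : nat) : int := \sum_(i < k) geo Q i.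

Lemma geo0 Q : geo Q 0 = 0.
Proof. exact: big_ord0. Qed.

Lemma geo20 Q : geo2 Q 0 = 0.
Proof. exact: big_ord0. Qed.

Lemma geoS Q k : geo Q k.+1 = geo Q k + Q ^+ k.
Proof. exact: big_ord_recr. Qed.

Lemma geo2S Q k : geo2 Q k.+1 = geo2 Q k + geo Q k.
Proof. exact: big_ord_recr. Qed.

Lemma exp_geo (Q : int) k : Q ^+ k = 1 + (Q - 1) * geo Q k.
Proof. by rewrite -subrX1 addrC subrK. Qed.

Lemma geo_geo2 Q k : geo Q k = k%:Z + (Q - 1) * geo2 Q k.
Proof.
elim: k => [|k IH]; first by rewrite geo0 geo20 mulr0.
by rewrite geoS geo2S exp_geo (intS k) {1}IH; ring.
Qed.

Lemma geoD Q a b : geo Q (a + b) = geo Q a + geo Q b + (Q - 1) * geo Q a * geo Q b.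
Proof. by rewrite /geo geo_addn -/(geo Q a) -/(geo Q b) exp_geo; ring. Qed.

Lemma geoM Q a b : geo Q (a * b) = geo Q a * geo (Q ^+ a) b.
Proof. exact: geo_muln. Qed.

Lemma geo2D Q a b : geo2 Q (a + b) = geo2 Q a + geo2 Q b + geo Q a * geo Q b.
Proof.
elim: b => [|b IH]; first by rewrite addn0 geo20 geo0; ring.
by rewrite addnS !geo2S geoS IH geoD exp_geo; ring.
Qed.

Lemma geo2_shiftD Q (r : bool) a b : geo2 Q (a + b + r) =
  geo2 Q (a + r) + geo2 Q (b + r) + Q ^+ r * geo Q a * geo Q b.
Proof.
case: r; last by rewrite !addn0 geo2D expr0 mul1r.
by rewrite !addn1 !geo2S geo2D geoD expr1; ring.
Qed.

Lemma geo2_expand Q k : exists w w', 2 * geo2 Q k = k%:Z * (k%:Z - 1) + (Q - 1) * w /\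
  3%:Z * w = k%:Z * (k%:Z - 1) * (k%:Z - 2) + (Q - 1) * w'.
Proof.
elim: k => [|k [w [w' [IH IH']]]]; first by exists 0, 0; rewrite geo20; split; ring.
exists (w + 2 * geo2 Q k), (w' + 3%:Z * w); split.
  by rewrite geo2S geo_geo2 !mulrDr !(mulrCA 2) IH (intS k); ring.
by rewrite mulrDr IH [X in X + _]IH' (intS k); ring.
Qed.

Lemma PoszX (p i : nat) : (p ^ i)%N%:Z = p%:Z ^+ i.
Proof. by rewrite -!natz natrX. Qed.

Lemma pX_dvdZ (p : nat) i k : (p%:Z ^+ i %| k%:Z)%Z = (p ^ i %| k)%N.
Proof. by rewrite -PoszX. Qed.

Section Cocycle.
Variables (Q t : int) (e : nat -> int).
Hypothesis eD : forall a b, e (a + b) = e a + e b + t * geo Q a * geo Q b.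

Lemma cocycle0 : e 0 = 0.
Proof. by have := eD 0 0; rewrite geo0 addn0; lia. Qed.

Lemma cocycleM a c : e (a * c) = c%:Z * e a + t * geo Q a ^+ 2 * geo2 (Q ^+ a) c.
Proof.
elim: c => [|c IH]; first by rewrite muln0 cocycle0 geo20; ring.
by rewrite mulnS addnC eD IH geoM geo2S (intS c); ring.
Qed.

Variable p : nat.
Hypotheses (pp : prime p) (Q1 : (p%:Z %| Q - 1)%Z).

Lemma geo_pX j : exists g, geo Q (p ^ j) = p%:Z ^+ j * g.
Proof.
have /dvdzP[g eg] := geo_dvd j Q1.
by exists g; rewrite -PoszX mulrC -eg.
Qed.

Lemma expQ1 k : (p%:Z %| Q ^+ k - 1)%Z.
Proof. by rewrite subrX1 dvdz_mulr. Qed.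

Lemma primez_dvdM (x y : int) : (p%:Z %| x * y)%Z = (p%:Z %| x)%Z || (p%:Z %| y)%Z.
Proof. by rewrite !dvdzE abszM Euclid_dvdM. Qed.

Let s := nat_of_bool (p == 2%N).

Lemma pX_dvdM i j (u : int) : ~~ (p%:Z %| u)%Z ->
  (p%:Z ^+ i %| p%:Z ^+ j * u)%Z = (i <= j)%N.
Proof.
move=> pu; have p0 : (p%:Z ^+ j != 0 :> int) by rewrite expf_neq0 // eqz_nat -lt0n prime_gt0.
apply/idP/idP => [|ij]; last by rewrite dvdz_mulr // dvdz_exp2l.
rewrite leqNgt; apply: contraL => ji.
rewrite -(subnKC (ltnW ji)) exprD dvdz_mul2l //.
by apply: contra pu; apply: dvdz_trans; rewrite -(subnKC ji) addSnnS addKn exprS dvdz_mulr.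
Qed.

Lemma cocycle_regular_pX j : (exists2 u, ~~ (p%:Z %| u)%Z & e p = p%:Z ^+ (1 - s) * u) ->
  exists2 u, ~~ (p%:Z %| u)%Z & e (p ^ j.+1) = p%:Z ^+ (j.+1 - s) * u.
Proof.
move=> [u0 hu0 e1]; elim: j => [|j [u hu IH]]; first by exists u0.
have [g eg] := geo_pX j.+1.
have [w ew] : exists w, geo2 (Q ^+ (p ^ j.+1)) p = p%:Z ^+ (1 - s) * w.
  have := expQ1 (p ^ j.+1); set R := Q ^+ _ => R1.
  rewrite /s; case: eqP => [|p2]; first by exists (geo2 R p); rewrite subnn mul1r.
  have [w0 [_ [ew0 _]]] := geo2_expand R p.
  suff /dvdzP[w ->] : (p%:Z %| geo2 R p)%Z by exists w; rewrite subn0 mulrC.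
  have : (p%:Z %| 2 * geo2 R p)%Z.
    by rewrite ew0 rpredD // dvdz_mulr.
  rewrite primez_dvdM => /orP[|//]; rewrite dvdzE /= => /dvdn_leq -/(_ isT).
  by have := prime_gt1 pp; lia.
exists (u + p%:Z * (p%:Z ^+ j * t * g ^+ 2 * w)).
  by rewrite rpredDr // dvdz_mulr.
rewrite [in LHS]expnSr cocycleM IH eg ew.
have [es e1s] : (j.+2 - s = (j.+1 - s).+1)%N /\ (j.+1 - s = j + (1 - s))%N.
  by rewrite /s; case: eqP => _; rewrite ?subn1 ?subn0 /= ?addn0 ?addn1.
by rewrite es e1s !exprS exprD; ring.
Qed.

Lemma cocycle_regular b i : (exists2 u, ~~ (p%:Z %| u)%Z & e p = p%:Z ^+ (1 - s) * u) ->
  (p %| b)%N -> (p%:Z ^+ i %| e b)%Z = (p ^ (i + s) %| b)%N.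
Proof.
move=> hreg; have [->|b0 pb] := posnP b; first by rewrite cocycle0 !dvdn0 dvdz0.
have [c cc eb] := pfactor_coprime pp b0.
have j0 : (0 < logn p b)%N by rewrite logn_gt0 mem_primes pp b0.
rewrite pfactor_dvdn //; move: (logn p b) j0 eb => [//|j] _ ->.
have [u hu eu] := cocycle_regular_pX j hreg.
have nc : ~~ (p %| c)%N by rewrite -prime_coprime.
have [g eg] := geo_pX j.+1.
have e1 : (j.+1 + j.+1 = (j.+1 - s) + (j + s).+1)%N.
  by rewrite /s; case: eqP => _; rewrite ?subn1 ?subn0 ?addn0 ?addn1 /= !addnS ?addSn.
rewrite mulnC cocycleM eu eg exprMn -exprM muln2 -addnn e1 exprD exprS.
set M := geo2 _ _; set A := p%:Z ^+ (j.+1 - s).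
have -> : c%:Z * (A * u) + t * (A * (p%:Z * p%:Z ^+ (j + s)) * g ^+ 2) * M
  = A * (c%:Z * u + p%:Z * (p%:Z ^+ (j + s) * t * g ^+ 2 * M)) by ring.
rewrite pX_dvdM; last first.
  by rewrite rpredDr; [rewrite primez_dvdM negb_or hu andbT | exact: dvdz_mulr (dvdzz _)].
by rewrite /s; case: eqP => _; rewrite ?subn1 ?subn0 ?addn0 ?addn1.
Qed.

End Cocycle.

(** * Modular fixed points as residues *)

Lemma count_mod d m r : (0 < d)%N ->
  count (fun k => k == r %[mod d]) (iota 0 (d * m)) = m.
Proof.
move=> d0; elim: m => [|m IH]; first by rewrite muln0.
rewrite mulnS addnC iotaD count_cat IH add0n.
have -> : iota (d * m) d = map (addn (d * m)) (iota 0 d) by rewrite -iotaDl addn0.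
rewrite count_map.
rewrite (@eq_in_count _ _ (pred1 (r %% d)%N)) => [|k].
  by rewrite count_uniq_mem ?iota_uniq // mem_iota /= add0n ltn_pmod // addn1.
by rewrite mem_iota add0n /= => kd; rewrite mulnC modnMDl modn_small.
Qed.

Lemma count_or (T : Type) (a b : pred T) s : (forall x, a x -> b x -> false) ->
  count (fun x => a x || b x) s = (count a s + count b s)%N.
Proof.
move=> ab; rewrite -(count_predUI a b) -[LHS]addn0; congr (_ + _)%N.
by rewrite (@eq_count _ _ pred0) ?count_pred0 // => x; apply/negP => /andP[/ab h /h].
Qed.

Section Padic.
Variable p : nat.
Hypothesis pp : prime p.
Let p0 : (0 < p)%N := prime_gt0 pp.
Implicit Types (q z : padic p).

Lemma pcong_nat n a b : pcong n (a%:R : padic p) b%:R <-> a = b %[mod p ^ n].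
Proof.
apply: (iff_trans (pcongP p0 _ _ _)); rewrite !zres_nat !modz_nat.
by split=> [[]|->].
Qed.

Lemma qiota_cong q n z k : principal_units p 1 q -> pcong n z k%:R ->
  pcong n (qiota q z) (\sum_(i < k) q ^+ i).
Proof.
move=> qU zk; have [fc fN] := qiotaP p0 qU.
have [a fa] : nbhs z (qiota q @^-1` pclass n (qiota q z)) by apply: fc; exists n.
have zk' := pcong_res p0 (maxn a n) z; set k' := `|_|%N in zk'.
have /= h := fa _ (pcong_sym (pcongW (leq_maxl a n) zk')).
apply: pcong_trans (pcong_sym h) _; rewrite fN; apply/(pcongP p0).
apply: zres_geo_mod => //; apply/pcong_nat.
exact: pcong_trans (pcong_sym (pcongW (leq_maxr a n) zk')) zk.
Qed.

Lemma modfix_cong q n z k : principal_units p 1 q -> pcong n z k%:R ->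
  modfix q n z <-> ((p ^ n)%N %| geo (zres q n) k - k%:Z)%Z.
Proof.
move=> qU zk; have h := qiota_cong qU zk.
have {h}e : modfix q n z <-> pcong n (\sum_(i < k) q ^+ i) k%:R.
  split=> z1; first exact: pcong_trans (pcong_sym h) (pcong_trans z1 zk).
  exact: pcong_trans h (pcong_trans z1 (pcong_sym zk)).
apply: (iff_trans e); apply: (iff_trans (pcongP p0 _ _ _)).
by rewrite zres_geo zres_nat -eqz_mod_dvd; split=> /eqP.
Qed.

Lemma pidealM_nat i n z k : (i <= n)%N -> pcong n z k%:R ->
  pideal i (z * (z - 1)) <-> (p ^ i %| k * k.-1)%N.
Proof.
move=> lin zk.
have /(pcongP p0) e := pcongW lin zk.
apply: (iff_trans (pidealP p0 _ _)).
have -> : zres (z * (z - 1)) i = (k%:Z * (k%:Z - 1) %% (p ^ i)%N)%Z.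
  rewrite /= e zres_nat modzMml modzMmr.
  by rewrite -modzMmr modzDml modzDmr -modzDmr modzNm modzDmr modzMmr.
case: k {zk e} => [|k]; first by rewrite mul0r mod0z mul0n dvdn0; split.
rewrite (_ : _ * _ = (k.+1 * k)%N%:Z); last by rewrite PoszM; lia.
by rewrite modz_nat; split=> [[/eqP]|/eqP ->].
Qed.

Lemma modfix_classes_card q n (P : pred nat) : principal_units p 1 q ->
  (forall k, ((p ^ n)%N %| geo (zres q n) k - k%:Z)%Z = P k) ->
  modfix_classes q n #= `I_(count P (iota 0 (p ^ n))).
Proof.
move=> qU hP; set s := [seq k <- iota 0 (p ^ n) | P k].
have us : uniq s by rewrite filter_uniq ?iota_uniq.
have ss k : (k \in s) = P k && (k < p ^ n)%N by rewrite mem_filter mem_iota.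
pose f i : set (padic p) := pclass n (nth 0%N s i)%:R.
have -> : count P (iota 0 (p ^ n)) = size s by rewrite size_filter.
have -> : modfix_classes q n = f @` `I_(size s).
  apply/seteqP; split=> [_ [z zfix <-]|_ [i /= si <-]].
    have zk := pcong_res p0 n z; set k := `|_|%N in zk.
    have ks : k \in s.
      rewrite ss -hP; apply/andP; split; first by apply/(modfix_cong qU zk).
      rewrite -ltz_nat gez0_abs ?zres_ge0 // -zres_mod ltz_mod //.
      by rewrite eqz_nat -lt0n expn_gt0 p0.
    exists (index k s); rewrite /= ?index_mem // /f nth_index //.
    apply/seteqP; split=> y /= yz; first exact: pcong_trans yz (pcong_sym zk).
    exact: pcong_trans yz zk.
  exists (nth 0%N s i)%:R => //; apply/(modfix_cong qU (pcong_refl _ _)).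
  by rewrite hP; have := mem_nth 0%N si; rewrite ss => /andP[].
apply: inj_card_eq => i j /set_mem /= si /set_mem /= sj fij.
apply/eqP; rewrite -(nth_uniq 0%N si sj us); apply/eqP.
have : f j (nth 0%N s i)%:R by rewrite -fij; apply: pcong_refl.
move=> /pcong_nat; have := mem_nth 0%N si; have := mem_nth 0%N sj.
by rewrite !ss => /andP[_ hj] /andP[_ hi]; rewrite !modn_small.
Qed.

End Padic.

(** * The exceptional point for p = 3 *)

Section Special.
Variables (Q t : int) (e : nat -> int).
Hypothesis eD : forall a b, e (a + b) = e a + e b + t * geo Q a * geo Q b.
Hypothesis Q1 : (3%:Z %| Q - 1)%Z.

Lemma geo2_3 R : geo2 R 3 = R + 2.
Proof. by rewrite !geo2S !geoS geo20 geo0 expr0 expr1; ring. Qed.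

Lemma cocycle_dvd3 j b : (3%:Z %| e 3)%Z -> (3 ^ j %| b)%N -> (3%:Z ^+ j %| e b)%Z.
Proof.
move=> e3 /dvdnP[c ->]; rewrite mulnC (cocycleM eD).
have G i : (3%:Z ^+ i %| geo Q (3 ^ i))%Z.
  by have [g ->] := geo_pX Q1 i; rewrite dvdz_mulr.
apply: rpredD; last by apply: dvdz_mulr; apply: dvdz_mull; rewrite expr2 dvdz_mulr.
apply: dvdz_mull.
elim: j => [|j IH]; first exact: dvd1z.
rewrite expnSr (cocycleM eD) (exprS _ j); apply: rpredD; first exact: dvdz_mul.
rewrite mulrC; apply: dvdz_mul; last by rewrite dvdz_mull // expr2 dvdz_mulr.
by rewrite geo2_3 -[_ + 2](subrK 3%:Z) rpredD // -addrA expQ1.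
Qed.

End Special.

Lemma geo_mod3 Q j b : (3%:Z %| Q - 1)%Z -> (3 ^ j %| b)%N ->
  exists w, geo Q b = b%:Z + 3%:Z ^+ j.+1 * w.
Proof.
move=> Q1 hb; have hD a c : geo2 Q (a + c) = geo2 Q a + geo2 Q c + 1 * geo Q a * geo Q c.
  by rewrite geo2D mul1r.
have g3 : (3%:Z %| geo2 Q 3)%Z by rewrite geo2_3 -[_ + 2](subrK 3%:Z) rpredD // -addrA.
have /dvdzP[w ew] := cocycle_dvd3 hD Q1 g3 hb.
move: Q1 => /dvdzP[v ev]; exists (v * w).
by rewrite geo_geo2 ew ev exprS; ring.
Qed.

Section SpecialSolutions.
Variables (Q t : int) (e : nat -> int).
Hypothesis eD : forall a b, e (a + b) = e a + e b + t * geo Q a * geo Q b.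
Hypotheses (Q1 : (3%:Z %| Q - 1)%Z) (t1 : (3%:Z %| t - 1)%Z).
Hypothesis e3 : (3%:Z ^+ 2 %| e 3)%Z.

(* [L] is the limit of [2 e(3^j) / 3^j - 3^j]: consecutive terms agree modulo 3^(j+1). *)
Lemma special_slope_pX K : exists L : int, [/\ (3%:Z %| L)%Z,
    2 * e (3 ^ K.+1) = 3%:Z ^+ K.+1 * (L + 3%:Z ^+ K.+1) &
    forall j, (j <= K)%N -> exists w,
      2 * e (3 ^ j.+1) = 3%:Z ^+ j.+1 * (L + 3%:Z ^+ j.+1) + 3%:Z ^+ (j.+1 + j.+2) * w].
Proof.
elim: K => [|K [L [L3 eL IH]]].
  move: e3 => /dvdzP[w ew]; exists (2 * 3%:Z * w - 3%:Z); split.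
  - by rewrite rpredB // mulrAC dvdz_mull.
  - by rewrite expn1 ew; ring.
  - move=> j; rewrite leqn0 => /eqP ->; exists 0; rewrite expn1 ew; ring.
have [w1 g1] := geo_mod3 Q1 (dvdnn (3 ^ K.+1)).
rewrite PoszX in g1.
have /dvdzP[w2 ew2] := t1.
have /dvdzP[w3 ew3] := Q1.
have et : t = 1 + 3%:Z * w2 by rewrite mulrC -ew2; ring.
have eQ : Q = 1 + 3%:Z * w3 by rewrite mulrC -ew3; ring.
set u := 3%:Z ^+ K in g1.
have [z ez] : exists z, 2 * e (3 ^ K.+2) =
    3%:Z ^+ K.+2 * (L + 3%:Z ^+ K.+2) + 3%:Z ^+ (K.+2 + K.+2) * z.
  exists (2 * (w2 + 2 * w1 + w1 ^+ 2 *3%:Z + w2 * (6 * w1 + 9 * w1 ^+ 2)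
   + w3 * u * (1 + 3%:Z * w1) ^+ 3 * (1 + 3%:Z * w2))).
  rewrite [in LHS]expnSr (cocycleM eD) mulrDr mulrCA eL geo2_3 (exp_geo Q) g1 et eQ.
  by rewrite !exprS exprD !exprS -/u; ring.
exists (L + 3%:Z ^+ K.+2 * z); split.
- by rewrite rpredD // exprS -mulrA dvdz_mulr.
- by rewrite ez exprD; ring.
move=> j; rewrite leq_eqVlt => /orP[/eqP ->|].
  by exists 0; rewrite ez exprD; ring.
rewrite ltnS => jK; have [w ew] := IH j jK.
exists (w - 3%:Z ^+ (K - j) * z); rewrite ew -(subnKC jK) !exprD !exprS !exprD addKn; ring.
Qed.

Lemma special_slope K : exists2 L : int, (3%:Z %| L)%Z &
  forall j b, (0 < j)%N -> (j <= K)%N -> (3 ^ j %| b)%N -> exists w,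
    2 * e b = b%:Z * (L + b%:Z) + 3%:Z ^+ (j + j).+1 * w.
Proof.
have [L [L3 _ hL]] := special_slope_pX K; exists L => // -[//|j] b _ jK /dvdnP[c ->].
have [w ew] := hL j (ltnW jK).
have [w1 g1] := geo_mod3 Q1 (dvdnn (3 ^ j.+1)).
have [w2 [_ [ew2 _]]] := geo2_expand (Q ^+ (3 ^ j.+1)) c.
have /dvdzP[w3 ew3] := expQ1 Q1 (3 ^ j.+1).
have /dvdzP[w4 ew4] := t1.
have et : t = 1 + 3%:Z * w4 by rewrite mulrC -ew4; ring.
rewrite mulnC (cocycleM eD) mulrDr !(mulrCA 2) ew ew2 ew3 g1 PoszM PoszX et.
rewrite addSn addnS !(exprS 3%:Z) exprD !(exprS 3%:Z); set u := 3%:Z ^+ j.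
exists (c%:Z * w + w3 * w2 * (1 + 3%:Z * w4) * (1 + 3%:Z * w1) ^+ 2 +
  c%:Z * (c%:Z - 1) * (w4 + (1 + 3%:Z * w4) * (2 * w1 + 3%:Z * w1 ^+ 2))).
ring.
Qed.

End SpecialSolutions.

Lemma pX_dvd_exact (p M : nat) (x : int) : ~~ (p%:Z ^+ M %| x)%Z ->
  exists i c, [/\ (i < M)%N, x = p%:Z ^+ i * c & ~~ (p%:Z %| c)%Z].
Proof.
elim: M => [|M IH]; first by rewrite dvd1z.
have [/dvdzP[c ec] hx|/IH[i [c [iM ex hc]]] _] := boolP (p%:Z ^+ M %| x)%Z.
  exists M, c; split=> //; first by rewrite mulrC.
  by apply: contra hx => /dvdzP[c' ec']; rewrite ec ec' exprS -mulrA dvdz_mull.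
by exists i, c; rewrite ltnW.
Qed.

Lemma dvd3X_2 i (x : int) : (3%:Z ^+ i %| 2 * x)%Z = (3%:Z ^+ i %| x)%Z.
Proof. by rewrite Gauss_dvdzr // coprimez_sym coprimezXr. Qed.

Lemma solve_mod3 (y c : int) : ~~ (3%:Z %| c)%Z ->
  exists k : nat, (3%:Z %| y + k%:Z * c)%Z.
Proof.
move=> hc; have : [|| (3%:Z %| y)%Z, (3%:Z %| y + c)%Z | (3%:Z %| y + 2 * c)%Z] by lia.
by case/or3P => h; [exists 0%N | exists 1%N | exists 2%N]; lia.
Qed.

Section Quadratic.
Variables (e : nat -> int) (L : int) (N : nat).
Hypothesis slope : forall j b, (0 < j)%N -> (j <= N)%N -> (3 ^ j %| b)%N ->
  exists w, 2 * e b = b%:Z * (L + b%:Z) + 3%:Z ^+ (j + j).+1 * w.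
Hypothesis cross : forall i j b x, (3 ^ j %| b)%N -> (3 ^ i %| x)%N ->
  exists w, 2 * e (b + x)%N = 2 * e b + 2 * e x + 2 * b%:Z * x%:Z + 3%:Z ^+ (i + j).+1 * w.
Hypothesis L3 : (3%:Z %| L)%Z.
Let p3 : prime 3 := isT.

Lemma quadratic_diff d i b b' : (d < i)%N -> (i <= N)%N ->
  (3 ^ d %| b)%N -> (3%:Z ^+ d.+1 %| L + b%:Z)%Z -> (3%:Z ^+ i %| b'%:Z - b%:Z)%Z ->
  exists w, 2 * e b' = 2 * e b + (b'%:Z - b%:Z) * b%:Z + 3%:Z ^+ (i + d).+1 * w.
Proof.
move=> di; rewrite -(subnKC di); move: (i - d.+1)%N => r {i di} iN.
have eAB : 3%:Z ^+ (d.+1 + r) = 3%:Z * 3%:Z ^+ d * 3%:Z ^+ r by rewrite exprD exprS.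
have e1 : 3%:Z ^+ (d.+1 + r + d).+1 = 9 * (3%:Z ^+ d) ^+ 2 * 3%:Z ^+ r.
  by rewrite exprS !exprD exprS; ring.
have e2 : 3%:Z ^+ (d.+1 + r + (d.+1 + r)).+1 = 27 * (3%:Z ^+ d) ^+ 2 * (3%:Z ^+ r) ^+ 2.
  by rewrite exprS !exprD exprS; ring.
wlog bb' : b b' / (b <= b')%N => [hw|] db dL /dvdzP[c ec].
  have [bb'|/ltnW b'b] := leqP b b'; first by apply: hw => //; apply/dvdzP; exists c.
  have eb' : b'%:Z = b%:Z + c * 3%:Z ^+ (d.+1 + r) by rewrite -ec; ring.
  have [|||w ew] := hw _ _ b'b.
  - rewrite -pX_dvdZ eb' eAB rpredD ?pX_dvdZ //; apply/dvdzP.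
    by exists (c * 3%:Z * 3%:Z ^+ r); ring.
  - by rewrite eb' eAB addrA -exprS rpredD // dvdz_mull ?dvdz_mulr.
  - by apply/dvdzP; exists (- c); rewrite eb'; ring.
  exists (3%:Z ^+ r * c ^+ 2 - w); move: ew; rewrite e1 eb' eAB => ->; ring.
pose x := (b' - b)%N.
have ex : x%:Z = c * 3%:Z ^+ (d.+1 + r) by rewrite /x -subzn.
have ix : (3 ^ (d.+1 + r) %| x)%N by rewrite -pX_dvdZ ex dvdz_mull.
have [w1 ew1] := cross db ix.
have [w2 ew2] := @slope (d.+1 + r) x isT iN ix.
move/dvdzP: dL => [l el].
have eL : L = l * (3%:Z * 3%:Z ^+ d) - b%:Z by rewrite -exprS -el addrK.
exists (w1 + 3 * 3%:Z ^+ r * w2 + c * l + 3%:Z ^+ r * c ^+ 2).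
rewrite -[X in e X](subnKC bb') -/x ew1 ew2 ec e1 e2 ex eL eAB; ring.
Qed.

Lemma quadratic_near d b b' : (d < N)%N -> (3 ^ d %| b)%N -> ~~ (3 ^ d.+1 %| b)%N ->
  (3%:Z ^+ d.+1 %| L + b%:Z)%Z -> (3%:Z ^+ d.+1 %| b'%:Z - b%:Z)%Z ->
  (d.*2 < N)%N -> (3%:Z ^+ N %| e b)%Z ->
  (3%:Z ^+ N %| e b')%Z = (3%:Z ^+ (N - d) %| b'%:Z - b%:Z)%Z.
Proof.
move=> dN db db' dL dbb' d2N hb.
have [c ec] := dvdnP db; have ecz : b%:Z = c%:Z * 3%:Z ^+ d by rewrite ec PoszM PoszX.
rewrite -dvd3X_2; rewrite -dvd3X_2 in hb.
have [h|h] := boolP (3%:Z ^+ (N - d) %| _)%Z.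
  have dNd : (d < N - d)%N by rewrite ltn_subRL addnn.
  have [w ->] := quadratic_diff dNd (leq_subr _ _) db dL h.
  rewrite subnK ?(ltnW dN) //; apply: rpredD; last first.
    by rewrite exprS -mulrA dvdz_mull // dvdz_mulr.
  apply: rpredD => //; move/dvdzP: h => [y ->]; apply/dvdzP; exists (y * c%:Z).
  by rewrite ecz -(subnK (ltnW dN)) addnK exprD; ring.
have [i [y [iN ey hy]]] := pX_dvd_exact h.
have di : (d < i)%N.
  by move: dbb'; rewrite ey (pX_dvdM p3).
have [||w ew] := @quadratic_diff d i b b' di _ db dL.
- by apply: leq_trans (ltnW iN) (leq_subr _ _).
- by rewrite ey dvdz_mulr.
rewrite ew ey -addrA rpredDl //.
have -> : 3%:Z ^+ i * y * b%:Z + 3%:Z ^+ (i + d).+1 * w =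
  3%:Z ^+ (i + d) * (y * c%:Z + 3%:Z * w) by rewrite ecz exprS exprD; ring.
rewrite (pX_dvdM p3); first by apply/negbTE; rewrite -ltnNge addnC -ltn_subRL.
rewrite rpredDr; last exact: dvdz_mulr (dvdzz _).
rewrite (primez_dvdM p3) negb_or hy /=; apply: contra db' => hk.
have /dvdnP[k ek] : (3 %| c)%N := hk.
by rewrite ec ek -mulnA -expnS dvdn_mull.
Qed.

Lemma quadratic_val j m b c l : (0 < j)%N -> (j <= N)%N -> (m <= j)%N ->
  b%:Z = 3%:Z ^+ j * c -> ~~ (3%:Z %| c)%Z ->
  L + b%:Z = 3%:Z ^+ m * l -> ~~ (3%:Z %| l)%Z ->
  (3%:Z ^+ N %| e b)%Z = (N <= j + m)%N.
Proof.
move=> j0 jN mj eb hc el hl.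
have jb : (3 ^ j %| b)%N by rewrite -pX_dvdZ eb dvdz_mulr.
have [w ew] := slope j0 jN jb.
have -> : (3%:Z ^+ N %| e b)%Z = (3%:Z ^+ N %| 2 * e b)%Z by rewrite dvd3X_2.
have -> : 2 * e b = 3%:Z ^+ (j + m) * (c * l + 3%:Z * (3%:Z ^+ (j - m) * w)).
  have ej : (j + j = j + m + (j - m))%N by rewrite -addnA subnKC.
  by rewrite ew el eb ej exprS !exprD; ring.
rewrite (pX_dvdM p3) // rpredDr; last exact: dvdz_mulr (dvdzz _).
by rewrite (primez_dvdM p3) negb_or hc.
Qed.

Lemma quadratic_solutions_pair d beta b : (0 < d)%N -> (d.*2 < N)%N ->
  (3 ^ d %| beta)%N -> ~~ (3 ^ d.+1 %| beta)%N -> (3%:Z ^+ N %| e beta)%Z ->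
  (3 %| b)%N ->
  (3%:Z ^+ N %| e b)%Z = (3 ^ (N - d) %| b)%N || (3%:Z ^+ (N - d) %| b%:Z - beta%:Z)%Z.
Proof.
move=> d0 d2N hd hd1 hbeta b3.
have dNd : (d < N - d)%N by rewrite ltn_subRL addnn.
have dN : (d < N)%N := leq_trans dNd (leq_subr _ _).
have [c ec] := dvdnP hd; have ecz : beta%:Z = 3%:Z ^+ d * c%:Z by rewrite ec PoszM PoszX mulrC.
have hc : ~~ (3%:Z %| c%:Z)%Z.
  apply: contra hd1 => hk; have /dvdnP[k ek] : (3 %| c)%N := hk.
  by rewrite ec ek -mulnA -expnS dvdn_mull.
have L_near x : (3 ^ d %| x)%N -> ~~ (3 ^ d.+1 %| x)%N -> (3%:Z ^+ N %| e x)%Z ->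
    (3%:Z ^+ d.+1 %| L + x%:Z)%Z.
  move=> dx hx hex; have [w ew] := slope d0 (ltnW dN) dx; have [y ey] := dvdnP dx.
  have eyz : x%:Z = 3%:Z ^+ d * y%:Z by rewrite ey PoszM PoszX mulrC.
  have hy : ~~ (3 %| y)%N.
    by apply: contra hx => /dvdnP[k ek]; rewrite ey ek -mulnA -expnS dvdn_mull.
  have : (3%:Z ^+ (d + d.+1) %| x%:Z * (L + x%:Z))%Z.
    have -> : x%:Z * (L + x%:Z) = 2 * e x - 3%:Z ^+ (d + d).+1 * w by rewrite ew addrK.
    rewrite -addnS; apply: rpredB; last exact: dvdz_mulr (dvdzz _).
    by apply/dvdz_mull/(dvdz_trans _ hex); rewrite dvdz_exp2l // addnS addnn.
  rewrite {1}eyz -mulrA exprD dvdz_mul2l ?expf_neq0 // Gauss_dvdzr //.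
  by rewrite coprimezXl // /coprimez /gcdz /= -[(_ == _)]/(coprime 3 y) prime_coprime.
have Lbeta := L_near _ hd hd1 hbeta.
have [hb|hb] /= := boolP (3 ^ (N - d) %| b)%N.
  have Nd0 : (0 < N - d)%N by rewrite subn_gt0.
  have [w ew] := slope Nd0 (leq_subr d N) hb.
  rewrite -dvd3X_2 ew; apply: rpredD; last first.
    apply/dvdz_mulr/dvdz_exp2l/(leq_trans _ (leqnSn _)).
    by rewrite -{1}(subnK (ltnW dN)) leq_add2l ltnW.
  have -> : 3%:Z ^+ N = 3%:Z ^+ (N - d) * 3%:Z ^+ d by rewrite -exprD subnK // ltnW.
  rewrite dvdz_mul ?pX_dvdZ //.
  have -> : L + b%:Z = (L + beta%:Z) + b%:Z - beta%:Z by ring.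
  apply: rpredB; last by rewrite pX_dvdZ.
  apply: rpredD; first by apply: dvdz_trans Lbeta; rewrite dvdz_exp2l.
  by rewrite pX_dvdZ; apply: dvdn_trans hb; rewrite dvdn_exp2l // ltnW.
have [hbb|hbb] := boolP (3%:Z ^+ d.+1 %| b%:Z - beta%:Z)%Z.
  exact: quadratic_near.
have -> : (3%:Z ^+ (N - d) %| b%:Z - beta%:Z)%Z = false.
  by apply: contraNF hbb; apply: dvdz_trans; rewrite dvdz_exp2l.
rewrite -pX_dvdZ in hb; have [j [y [jN ey hy]]] := pX_dvd_exact hb.
have j0 : (0 < j)%N.
  case: j ey {jN} => // ey; have : (3%:Z %| b%:Z)%Z := b3.
  by rewrite ey mul1r (negPf hy).
have jN' : (j <= N)%N := leq_trans (ltnW jN) (leq_subr _ _).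
have [l el] := dvdzP Lbeta.
have eL : L = 3%:Z * l * 3%:Z ^+ d - 3%:Z ^+ d * c%:Z.
  by rewrite -ecz -mulrA mulrCA -exprS -el addrK.
have [jd|dj|jd] := ltngtP j d.
- have eLb : L + b%:Z = 3%:Z ^+ j * (y + 3%:Z * (3%:Z ^+ (d - j.+1) * (3%:Z * l - c%:Z))).
    by rewrite eL ey -[in LHS](subnKC jd) exprD exprS; ring.
  rewrite (quadratic_val j0 jN' (leqnn _) ey hy eLb).
    by apply/negbTE; rewrite -ltnNge (leq_ltn_trans _ d2N) // -addnn leq_add // ltnW.
  by rewrite rpredDr //; apply: dvdz_mulr (dvdzz _).
- have eLb : L + b%:Z = 3%:Z ^+ d * (- c%:Z + 3%:Z * (3%:Z ^+ (j - d.+1) * y + l)).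
    by rewrite eL ey -[in LHS](subnKC dj) exprD exprS; ring.
  rewrite (quadratic_val j0 jN' (ltnW dj) ey hy eLb).
    by apply/negbTE; rewrite -ltnNge addnC -ltn_subRL.
  by rewrite rpredDr ?rpredN //; apply: dvdz_mulr (dvdzz _).
- apply: contraNF hbb => hb'; rewrite jd in ey.
  have db : (3 ^ d %| b)%N by rewrite -pX_dvdZ ey dvdz_mulr.
  have db1 : ~~ (3 ^ d.+1 %| b)%N.
    by rewrite -pX_dvdZ ey (pX_dvdM p3) // ltnn.
  have -> : b%:Z - beta%:Z = (L + b%:Z) - (L + beta%:Z) by ring.
  by rewrite rpredB // L_near.
Qed.

(* Hensel lifting: moving [beta] by x changes [2 e(beta)] by [x * beta] to leading order. *)
Lemma quadratic_root_ex d l : (0 < d)%N -> (d.*2 < N)%N -> L = 3%:Z ^+ d * l ->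
  ~~ (3%:Z %| l)%Z -> exists beta, [/\ (3 ^ d %| beta)%N, ~~ (3 ^ d.+1 %| beta)%N
    & (3%:Z ^+ N %| e beta)%Z].
Proof.
move=> d0 d2N eL hl.
have dN : (d <= N)%N by rewrite -addnn in d2N; apply: leq_trans (leq_addr d d) (ltnW d2N).
suff H m : (d.*2.+1 + m <= N)%N -> exists beta, [/\ (3 ^ d %| beta)%N,
    (3%:Z ^+ d.+1 %| L + beta%:Z)%Z & (3%:Z ^+ (d.*2.+1 + m) %| e beta)%Z].
  have [|beta [h1 h2 h3]] := H (N - d.*2.+1)%N; first by rewrite subnKC.
  exists beta; split=> //; last by rewrite subnKC in h3.
  apply/negP; rewrite -pX_dvdZ => h.
  have : (3%:Z ^+ d.+1 %| L)%Z by rewrite -(addrK beta%:Z L) rpredB.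
  by rewrite eL (pX_dvdM p3) // ltnn.
have db x : (3%:Z ^+ d.+1 %| L + x%:Z)%Z -> (3 ^ d %| x)%N.
  move=> hx; rewrite -pX_dvdZ (_ : x%:Z = (L + x%:Z) - L); last by ring.
  rewrite rpredB //; last by rewrite eL dvdz_mulr.
  by apply: dvdz_trans hx; rewrite dvdz_exp2l.
elim: m => [_|m IH hm].
  pose P := 3%:Z ^+ d.+1; pose beta := `|(- L %% P)%Z|%N.
  have hb : (P %| L + beta%:Z)%Z.
    rewrite gez0_abs ?modz_ge0 ?expf_neq0 //; apply/dvdzP; exists (- (- L %/ P)%Z).
    have -> : (- L %% P)%Z = - L - (- L %/ P)%Z * P.
      by apply/eqP; rewrite eq_sym subr_eq addrC -divz_eq.
    by ring.
  exists beta; split=> //; first exact: db.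
  have [w ew] := slope d0 dN (db _ hb).
  rewrite -dvd3X_2 ew addn0 -addnn; apply: rpredD; last exact: dvdz_mulr (dvdzz _).
  by rewrite -addnS exprD dvdz_mul // pX_dvdZ db.
have [|beta [dbeta dL hbeta]] := IH; first by apply: leq_trans hm; rewrite leq_add2l.
have [c ec] := dvdnP dbeta.
have ecz : beta%:Z = 3%:Z ^+ d * c%:Z by rewrite ec PoszM PoszX mulrC.
have hc : ~~ (3%:Z %| c%:Z)%Z.
  apply/negP => /dvdzP[k ek].
  have : (3%:Z ^+ d.+1 %| L)%Z.
    rewrite -(addrK beta%:Z L) rpredB // ecz ek exprS; apply/dvdzP; exists k; ring.
  by rewrite eL (pX_dvdM p3) // ltnn.
rewrite -dvd3X_2 in hbeta; have [y ey] := dvdzP hbeta.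
have [k hk] := solve_mod3 y hc.
have iN : (d.+1 + m <= N)%N by apply: leq_trans hm; rewrite -addnn; lia.
have di : (d < d.+1 + m)%N by rewrite addSn ltnS leq_addr.
pose beta' := (beta + 3 ^ (d.+1 + m) * k)%N.
have ebb : beta'%:Z - beta%:Z = 3%:Z ^+ (d.+1 + m) * k%:Z.
  by rewrite /beta' PoszD PoszM PoszX; ring.
have [|w ew] := @quadratic_diff d (d.+1 + m) beta beta' di iN dbeta dL.
  by rewrite ebb dvdz_mulr.
have hL' : (3%:Z ^+ d.+1 %| L + beta'%:Z)%Z.
  have -> : L + beta'%:Z = L + beta%:Z + (beta'%:Z - beta%:Z) by ring.
  by rewrite ebb rpredD // dvdz_mulr // dvdz_exp2l // leq_addr.
exists beta'; split=> //; first exact: db.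
rewrite -dvd3X_2 ew ey ebb ecz.
have ei : (d.+1 + m + d = d.*2.+1 + m)%N by rewrite -addnn; lia.
have -> : y * 3%:Z ^+ (d.*2.+1 + m) + 3%:Z ^+ (d.+1 + m) * k%:Z * (3%:Z ^+ d * c%:Z)
   + 3%:Z ^+ (d.+1 + m + d).+1 * w = 3%:Z ^+ (d.*2.+1 + m) * (y + k%:Z * c%:Z + 3%:Z * w).
  by rewrite -ei exprS !exprD; ring.
by rewrite addnS exprSr dvdz_mul // rpredD // dvdz_mulr.
Qed.

Lemma quadratic_solutions_center M b : (0 < M)%N -> (M <= N)%N ->
  (N <= M.*2)%N -> (M.*2 <= N.+1)%N ->
  (forall beta, (3 %| beta)%N -> (3%:Z ^+ N %| e beta)%Z -> (3 ^ M %| beta)%N) ->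
  (3 %| b)%N -> (3%:Z ^+ N %| e b)%Z = (3 ^ M %| b)%N.
Proof.
move=> M0 MN NM MN1 hM b3; apply/idP/idP => [|hb]; first exact: hM.
have hL : (3%:Z ^+ (N - M) %| L)%Z.
  apply: contraT => /pX_dvd_exact[d [l [dM eL hl]]].
  have d0 : (0 < d)%N.
    by case: d eL {dM} => // eL; move: hl; rewrite -[l]mul1r -eL L3.
  have dM' : (d < M)%N by apply: leq_trans dM _; rewrite leq_subLR addnn.
  have d2N : (d.*2 < N)%N by rewrite -addnn -(subnK MN) -addSn leq_add // ltnW.
  have [beta [h1 h2 h3]] := quadratic_root_ex d0 d2N eL hl.
  have b3' : (3 %| beta)%N by apply: dvdn_trans h1; rewrite -{1}(expn1 3) dvdn_exp2l.
  case/negP: h2; apply: dvdn_trans (hM _ b3' h3); by rewrite dvdn_exp2l.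
have [w ew] := slope M0 MN hb.
rewrite -dvd3X_2 ew; apply: rpredD; last by apply/dvdz_mulr/dvdz_exp2l/leqW; rewrite addnn.
rewrite mulrDr rpredD //.
  by rewrite -(subnKC MN) exprD dvdz_mul ?pX_dvdZ.
apply: (@dvdz_trans (3%:Z ^+ (M + M))); first by rewrite dvdz_exp2l // addnn.
by rewrite exprD dvdz_mul ?pX_dvdZ.
Qed.

End Quadratic.

Lemma special_cross Q t e : (forall a b, e (a + b) = e a + e b + t * geo Q a * geo Q b) ->
  (3%:Z %| Q - 1)%Z -> (3%:Z %| t - 1)%Z ->
  forall i j b x, (3 ^ j %| b)%N -> (3 ^ i %| x)%N ->
  exists w, 2 * e (b + x)%N = 2 * e b + 2 * e x + 2 * b%:Z * x%:Z + 3%:Z ^+ (i + j).+1 * w.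
Proof.
move=> eD Q1 /dvdzP[w3 e3] i j b x hb hx.
have [w1 e1] := geo_mod3 Q1 hb; have [w2 e2] := geo_mod3 Q1 hx.
have et : t = 1 + 3%:Z * w3 by rewrite mulrC -e3; ring.
move: hb hx; rewrite -!pX_dvdZ => /dvdzP[y ey] /dvdzP[y' ey'].
exists (2 * (w3 * y * y' + (1 + 3%:Z * w3) * (y * w2 + w1 * y' + 3%:Z * w1 * w2))).
by rewrite eD e1 e2 et ey ey' !(exprS 3%:Z) exprD; ring.
Qed.

Lemma dvdn_mul_pred (p i b : nat) (r : bool) : prime p -> (p %| b)%N ->
  (p ^ i %| (b + r) * (b + r).-1)%N = (p ^ i %| b)%N.
Proof.
move=> pp pb; have cop m : coprime p m -> coprime (p ^ i) m by exact: coprimeXl.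
case: r; rewrite ?addn1 ?addn0 /=.
  rewrite Gauss_dvdr // cop // prime_coprime //.
  by rewrite -addn1 dvdn_addr // dvdn1 neq_ltn prime_gt1 ?orbT.
case: b pb => [|b] pb; first by rewrite mul0n.
rewrite /= Gauss_dvdl // cop // prime_coprime //; apply: contraL pb => pb.
by rewrite -addn1 dvdn_addr // dvdn1 neq_ltn prime_gt1 ?orbT.
Qed.

Lemma eqn_mod_shift (d b : nat) r : (b + r == r %[mod d]) = (d %| b)%N.
Proof. by rewrite -{2}[r]add0n eqn_modDr mod0n. Qed.

Lemma mod_ge_bool (p k : nat) (r : bool) : prime p -> k = r %[mod p] -> (r <= k)%N.
Proof.
by case: r => // pp; case: k => //; rewrite mod0n modn_small // prime_gt1.
Qed.

Lemma eqn_mod_pXW (p i k r : nat) : (0 < i)%N -> k == r %[mod p ^ i] -> k == r %[mod p].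
Proof.
move=> i0 /eqP h; apply/eqP; have pd : (p %| p ^ i)%N by rewrite dvdn_exp.
by rewrite -(modn_dvdm k pd) h modn_dvdm.
Qed.

(** * Roots of [geo2] modulo prime powers *)

Section Base.
Variables (p : nat) (Q : int).
Hypotheses (pp : prime p) (Q1 : (p%:Z %| Q - 1)%Z).

Lemma geo2_unit k : p != 2%N -> k != 0 %[mod p] -> k != 1 %[mod p] -> ~~ (p%:Z %| geo2 Q k)%Z.
Proof.
move=> p2 k0 k1; have [w [_ [ew _]]] := geo2_expand Q k.
apply/negP => hk.
have : (p%:Z %| k%:Z * (k%:Z - 1))%Z.
  rewrite -[_ * _](addrK ((Q - 1) * w)) -ew rpredB //; first exact: dvdz_mull.
  exact: dvdz_mulr.
rewrite (primez_dvdM pp) => /orP[hk'|].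
  by move: k0; rewrite mod0n => /negP; apply.
by rewrite -eqz_mod_dvd !modz_nat eqz_nat (negPf k1).
Qed.

Lemma geo2_regular_base (r : bool) : p <> 3%N \/ (p%:Z ^+ 2 %| Q - 1)%Z ->
  exists2 u, ~~ (p%:Z %| u)%Z & geo2 Q (p + r) = p%:Z ^+ (1 - (p == 2%N)) * u.
Proof.
move=> h3; have [p2|p2] := eqVneq p 2%N.
  exists (geo2 Q (p + r)); last by rewrite mul1r.
  have Q1' := Q1; rewrite p2 in Q1' *; case: r;
    rewrite ?addn0 ?addn1 !geo2S !geoS geo20 geo0 expr0 ?expr1; lia.
rewrite subn0 expr1.
have p_gt2 : (2 < p)%N by rewrite ltn_neqAle eq_sym p2 prime_gt1.
have small m : (0 < m < p)%N -> ~~ (p%:Z %| m%:Z)%Z.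
  case/andP => m0 mp; apply: contraL mp => /dvdn_leq h; rewrite -leqNgt; exact: h.
have [w [w' [ew ew']]] := geo2_expand Q p.
have [v ev] : exists v, (Q - 1) * w = p%:Z ^+ 2 * v.
  have [p3|p3] := eqVneq p 3%N.
    case: h3 => // /dvdzP[v ->]; exists (v * w); ring.
  have : (p%:Z %| w)%Z.
    have : (p%:Z %| 3%:Z * w)%Z by rewrite ew' rpredD // ?dvdz_mulr.
    rewrite (primez_dvdM pp) => /orP[|//]; rewrite (negPf (small 3 _)) //.
    by rewrite /= ltn_neqAle eq_sym p3.
  move=> /dvdzP[y ->]; move: Q1 => /dvdzP[y' ->]; exists (y' * y); ring.
have [u eu] : exists u, geo2 Q p = p%:Z * u.
  have : (p%:Z %| 2%:Z * geo2 Q p)%Z.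
    by rewrite ew ev expr2 -mulrA -mulrDr dvdz_mulr.
  rewrite (primez_dvdM pp) (negPf (small 2 _)) //= => /dvdzP[u ->].
  by exists u; rewrite mulrC.
have pz : p%:Z != 0 by rewrite eqz_nat -lt0n prime_gt0.
have e2u : 2 * u = p%:Z - 1 + p%:Z * v.
  by apply: (mulfI pz); rewrite mulrCA -eu ew ev; ring.
case: r; rewrite ?addn0 ?addn1; last first.
  exists u => //; apply/negP => hu.
  have : (p%:Z %| 1%:Z)%Z.
    have -> : 1%:Z = p%:Z * (1 + v) - 2 * u by rewrite e2u; ring.
    by apply: rpredB; [exact: dvdz_mulr (dvdzz _) | exact: dvdz_mull].
  by apply/negP/(small 1); rewrite /= ltnW.
exists (u + 1 + (Q - 1) * u); last by rewrite geo2S geo_geo2 eu; ring.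
rewrite rpredDr; last exact: dvdz_mulr.
apply/negP => hu; have : (p%:Z %| 1%:Z)%Z.
  have -> : 1%:Z = 2 * (u + 1) - p%:Z * (1 + v) by rewrite mulrDr e2u; ring.
  by apply: rpredB; [exact: dvdz_mull | exact: dvdz_mulr (dvdzz _)].
by apply/negP/(small 1); rewrite /= ltnW.
Qed.

Lemma geo2_regular (r : bool) i k :
  (exists2 u, ~~ (p%:Z %| u)%Z & geo2 Q (p + r) = p%:Z ^+ (1 - (p == 2%N)) * u) ->
  k = r %[mod p] ->
  (p%:Z ^+ i %| geo2 Q k)%Z = (k == r %[mod p ^ (i + (p == 2%N))]).
Proof.
move=> hreg kr; have rk := mod_ge_bool pp kr; rewrite -(subnK rk) in kr *.
move/eqP: kr; rewrite eqn_mod_shift => pb.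
rewrite eqn_mod_shift; exact: (cocycle_regular (geo2_shiftD Q r) pp Q1).
Qed.

Lemma geo2_regular_roots i k : (0 < i)%N -> p <> 3%N \/ (p%:Z ^+ 2 %| Q - 1)%Z ->
  (p%:Z ^+ i %| geo2 Q k)%Z =
  (k == 0 %[mod p ^ (i + (p == 2%N))]) || (k == 1 %[mod p ^ (i + (p == 2%N))]).
Proof.
move=> i0 h3.
have sub (r : bool) : k == r %[mod p ^ (i + (p == 2%N))] -> k == r %[mod p].
  by apply: eqn_mod_pXW; rewrite ltn_addr.
have not01 : k == 0 %[mod p] -> k == 1 %[mod p] -> false.
  by move=> /eqP -> ; rewrite mod0n modn_small // prime_gt1.
have [k0|k0] := boolP (k == 0 %[mod p]).
  rewrite (geo2_regular i (geo2_regular_base false h3) (eqP k0)).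
  have [h1|_] := boolP (k == 1 %[mod _]); last by rewrite orbF.
  by have := not01 k0 (sub true h1).
rewrite (negPf (contra (sub false) k0)) /=.
have [k1|k1] := boolP (k == 1 %[mod p]).
  exact: (geo2_regular i (geo2_regular_base true h3) (eqP k1)).
rewrite (negPf (contra (sub true) k1)).
have [p2|p2] := eqVneq p 2%N.
  by move: k0 k1; rewrite p2 !modn2; case: odd.
apply: contraNF (geo2_unit p2 k0 k1); apply: dvdz_trans.
by have := dvdz_exp2l p%:Z i0; rewrite expr1.
Qed.

End Base.

Lemma count_mod_pX (p i n r : nat) : (0 < p)%N -> (i <= n)%N ->
  count (fun k => k == r %[mod p ^ i]) (iota 0 (p ^ n)) = (p ^ (n - i))%N.
Proof. by move=> p0 lin; rewrite -(subnKC lin) expnD count_mod ?expn_gt0 ?p0 // addKn. Qed.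

Lemma principal_unitsP (p m : nat) (q : padic p) : principal_units p m q <-> pcong m q 1.
Proof.
by split=> [[s _ <-]|[s _ e]]; exists s => //; rewrite ?e; ring.
Qed.

Lemma eqn_mod01 d : (1 < d)%N -> 0 = 1 %[mod d] -> False.
Proof. by move=> d1; rewrite mod0n modn_small. Qed.

(** * Counting *)

Section Main.
Variables (p : nat) (q : padic p) (n : nat).
Hypotheses (pp : prime p) (qU : principal_units p 1 q).
Let p0 := prime_gt0 pp.
Let Q := zres q n.

Lemma pcong_one i : (i <= n)%N -> pcong i q 1 <-> (p%:Z ^+ i %| Q - 1)%Z.
Proof.
move=> lin; apply: (iff_trans (pcongP p0 _ _ _)).
by rewrite (zres_leq q lin) -PoszX -eqz_mod_dvd; split=> /eqP.
Qed.

Variable m0 : nat.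
Hypotheses (qn : ~ pcong n q 1) (vq : vp (q - 1) = (m0%:Z)%:E).

Lemma m0_bounds : (0 < m0 < n)%N.
Proof.
have [h1 h2] := (vpP _ _).1 vq; apply/andP; split.
  rewrite lt0n; apply/eqP => m00; apply: h2; rewrite m00.
  exact/principal_unitsP.
by rewrite ltnNge; apply/negP => nm; apply: qn; exact: pcongW nm h1.
Qed.

Lemma zresq_sub1 : exists2 u, ~~ (p%:Z %| u)%Z & Q - 1 = p%:Z ^+ m0 * u.
Proof.
have /andP[_ m0n] := m0_bounds.
have [/(pcong_one (ltnW m0n)) h1 h2] := (vpP _ _).1 vq.
have /dvdzP[u eu] := h1; exists u; last by rewrite mulrC.
apply/negP => hu; apply: h2; apply/(pcong_one m0n).
by rewrite eu exprS dvdz_mul.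
Qed.

Lemma zresq_sub1_dvd : (p%:Z %| Q - 1)%Z.
Proof.
have /andP[m00 _] := m0_bounds; have [u _ ->] := zresq_sub1.
by case: m0 m00 => // m _; rewrite exprS -mulrA dvdz_mulr.
Qed.

Lemma modfix_geo2 k : ((p ^ n)%N %| geo Q k - k%:Z)%Z = (p%:Z ^+ (n - m0) %| geo2 Q k)%Z.
Proof.
have /andP[_ m0n] := m0_bounds; have [u hu eu] := zresq_sub1.
rewrite PoszX geo_geo2 [_ + _ * _]addrC addrK eu -mulrA -[in LHS](subnKC (ltnW m0n)) exprD.
rewrite dvdz_mul2l ?expf_neq0 ?eqz_nat -?lt0n // Gauss_dvdzr //.
by rewrite coprimezXl // /coprimez /gcdz /= -[(_ == _)]/(coprime p `|u|) prime_coprime.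
Qed.

Lemma modfix_classes_card_regular : p <> 3%N \/ (p%:Z ^+ 2 %| Q - 1)%Z ->
  modfix_classes q n #= `I_(2 * p ^ (m0 - (p == 2%N))).
Proof.
move=> h3; have /andP[m00 m0n] := m0_bounds.
set s := nat_of_bool (p == 2%N).
have sm : (s <= m0)%N by apply: leq_trans m00; rewrite /s; case: eqP.
set i := (n - m0 + s)%N.
have i0 : (0 < i)%N by rewrite ltn_addr // subn_gt0.
have iE : (n - i = m0 - s)%N by rewrite /i; lia.
have lin : (i <= n)%N by rewrite /i; lia.
have nm : (0 < n - m0)%N by rewrite subn_gt0.
have hP k := etrans (modfix_geo2 k) (geo2_regular_roots pp zresq_sub1_dvd k nm h3).
have := modfix_classes_card pp qU hP.
rewrite count_or => [|k /eqP e0 /eqP e1]; last first.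
  by case: (@eqn_mod01 (p ^ i)); rewrite -?e0 // -(exp1n i) ltn_exp2r // prime_gt1.
by rewrite !count_mod_pX // iE addnn -mul2n.
Qed.

End Main.

Lemma special_base (Q u : int) : ~~ (3%:Z %| u)%Z -> Q - 1 = 3%:Z * u ->
  exists r : bool, (3%:Z ^+ 2 %| geo2 Q (3 + r))%Z /\
    exists2 u', ~~ (3%:Z %| u')%Z & geo2 Q (3 + ~~ r) = 3%:Z ^+ (1 - (3 == 2)%N) * u'.
Proof.
move=> hu eu; have eQ : Q = 1 + 3%:Z * u by rewrite -eu; ring.
have g3 : geo2 Q 3 = 3%:Z * (1 + u) by rewrite geo2_3 eQ; ring.
have g4 : geo2 Q 4 = 3%:Z * (2 + u + 3%:Z * (u + u ^+ 2)).
  by rewrite geo2S g3 !geoS geo0 eQ; ring.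
have [h|h] := boolP (3%:Z %| u - 1)%Z.
  exists true; rewrite addn1 addn0 g3 g4; split; last by exists (1 + u) => //; lia.
  by rewrite exprS dvdz_mul //; lia.
exists false; rewrite addn1 addn0 g3 g4; split; first by rewrite exprS dvdz_mul //; lia.
exists (2 + u + 3%:Z * (u + u ^+ 2)) => //; rewrite rpredDr; last exact: dvdz_mulr (dvdzz _).
by apply: contra h => h; rewrite (_ : u - 1 = 2 + u - 3%:Z) ?rpredB //; ring.
Qed.

Lemma special_roots (Q u : int) (N : nat) : ~~ (3%:Z %| u)%Z ->
  Q - 1 = 3%:Z * u -> (0 < N)%N -> exists r : bool,
  [/\ forall k, (3%:Z ^+ N %| geo2 Q k)%Z =
        (k == ~~ r %[mod 3 ^ N]) || (k == r %[mod 3]) && (3%:Z ^+ N %| geo2 Q k)%Z,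
      forall d beta b, (0 < d)%N -> (d.*2 < N)%N -> (3 ^ d %| beta)%N ->
        ~~ (3 ^ d.+1 %| beta)%N -> (3%:Z ^+ N %| geo2 Q (beta + r))%Z -> (3 %| b)%N ->
        (3%:Z ^+ N %| geo2 Q (b + r))%Z =
        (3 ^ (N - d) %| b)%N || (3%:Z ^+ (N - d) %| b%:Z - beta%:Z)%Z
    & forall M b, (0 < M)%N -> (M <= N)%N -> (N <= M.*2)%N -> (M.*2 <= N.+1)%N ->
        (forall beta, (3 %| beta)%N -> (3%:Z ^+ N %| geo2 Q (beta + r))%Z ->
           (3 ^ M %| beta)%N) ->
        (3 %| b)%N -> (3%:Z ^+ N %| geo2 Q (b + r))%Z = (3 ^ M %| b)%N].
Proof.
move=> hu eu N0; have [r [h9 hreg]] := special_base hu eu.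
have Q1 : (3%:Z %| Q - 1)%Z by rewrite eu dvdz_mulr.
have t1 := expQ1 Q1 r.
have eD a b : geo2 Q (a + b + r) = _ := geo2_shiftD Q r a b.
have [L L3 slope] := special_slope eD Q1 t1 h9 N.
have cross := special_cross eD Q1 t1.
have p3 : prime 3 := isT.
exists r; split=> [k|d beta b|M b].
- have [k1|k1] := boolP (k == ~~ r %[mod 3]).
    rewrite (geo2_regular p3 Q1 N hreg (eqP k1)) addn0.
    by rewrite andbC; case: eqP.
  rewrite (negPf (contra (eqn_mod_pXW N0) k1)) /=.
  have [//|k2] := boolP (k == r %[mod 3]).
  apply: contraNF (_ : ~~ (3%:Z %| geo2 Q k)%Z).
    by apply: dvdz_trans; have := dvdz_exp2l 3%:Z N0; rewrite expr1.
  by apply: geo2_unit => //; case: (r) k1 k2.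
- exact: (quadratic_solutions_pair slope cross).
- exact: (quadratic_solutions_center slope cross L3).
Qed.

Section SpecialMain.
Variables (q : padic 3) (N : nat).
Hypotheses (qU : principal_units 3 1 q) (qn : ~ pcong N.+1 q 1) (vq : vp (q - 1) = (1%:Z)%:E).
Let p3 : prime 3 := isT.

Lemma modfix_classes_card_special (v0 : nat) : is_least_value q N.+1 (v0%:Z)%:E ->
  ((v0.*2 < N)%N -> modfix_classes q N.+1 #= `I_(2 * 3 ^ (v0 + 1) + 3)) /\
  ((N <= v0.*2)%N -> modfix_classes q N.+1 #= `I_(3 ^ (N.+1 - N.+1 %/ 2) + 3)).
Proof.
have /andP[_ n1] := m0_bounds qU qn vq.
have N0 : (0 < N)%N := n1.
have [u hu eu] := zresq_sub1 p3 qU qn vq; rewrite expr1 in eu.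
have [r [hP hA hB]] := special_roots hu eu N0.
have fixP k : ((3 ^ N.+1)%N %| geo (zres q N.+1) k - k%:Z)%Z =
    (3%:Z ^+ N %| geo2 (zres q N.+1) k)%Z.
  by rewrite (modfix_geo2 p3 qU qn vq) subn1.
have shift i k : (3 %| k)%N -> (3 ^ i %| (k + r) * (k + r).-1)%N = (3 ^ i %| k)%N.
  exact: dvdn_mul_pred.
move=> [[v00 [z zfix zv]] vmin]; split=> hv.
- set k := `|zres z (N.+1 + v0).+1|%N.
  have zk : pcong (N.+1 + v0).+1 z k%:R := pcong_res (prime_gt0 p3) _ z.
  have zk' : pcong N.+1 z k%:R by apply: pcongW zk; rewrite -addnS leq_addr.
  have [vz1 vz2] := (vpP _ _).1 (esym zv).
  have kv1 : (3 ^ v0 %| k * k.-1)%N.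
    by apply/(pidealM_nat p3 _ zk) => //; rewrite leqW // leq_addl.
  have kv2 : ~~ (3 ^ v0.+1 %| k * k.-1)%N.
    apply/negP => h; apply: vz2; apply/(pidealM_nat p3 _ zk) => //.
    by rewrite -addnS leq_addl.
  have kfix : (3%:Z ^+ N %| geo2 (zres q N.+1) k)%Z.
    by rewrite -fixP; apply/(modfix_cong p3 qU zk').
  have v0pos : (0 < v0)%N by rewrite lt0n; apply/eqP => v0e; apply: v00; rewrite v0e.
  have kr : k == r %[mod 3].
    move: kfix; rewrite hP => /orP[k1|/andP[]//].
    have /eqP k1' := eqn_mod_pXW N0 k1.
    have rk := mod_ge_bool p3 k1'.
    move: kv2 k1 => /negP; rewrite -(subnK rk) eqn_mod_shift => kv2 hN; case: kv2.
    have h3 : (3 %| k - ~~ r)%N by apply: dvdn_trans hN; rewrite dvdn_exp.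
    rewrite dvdn_mul_pred //; apply: dvdn_trans hN; rewrite dvdn_exp2l //.
    by apply: leq_trans hv; rewrite ltnS -addnn leq_addr.
  have rk := mod_ge_bool p3 (eqP kr).
  set beta := (k - r)%N; have ek : k = (beta + r)%N by rewrite subnK.
  rewrite ek in kv1 kv2 kfix kr; rewrite eqn_mod_shift in kr.
  rewrite !shift // in kv1 kv2.
  have Nv : (v0 < N - v0)%N by rewrite ltn_subRL addnn.
  have Nv0 : (0 < N - v0)%N := leq_ltn_trans (leq0n _) Nv.
  have hfix j : ((3 ^ N.+1)%N %| geo (zres q N.+1) j - j%:Z)%Z =
     (j == ~~ r %[mod 3 ^ N]) ||
     ((j == r %[mod 3 ^ (N - v0)]) || (j == beta + r %[mod 3 ^ (N - v0)])).
    rewrite fixP hP; congr orb.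
    have [jr|jr] /= := boolP (j == r %[mod 3]).
      have rj := mod_ge_bool p3 (eqP jr).
      rewrite -(subnK rj) eqn_mod_shift in jr *.
      rewrite (hA v0 beta) // eqn_mod_shift eqn_modDr; congr orb.
      by rewrite -PoszX -eqz_mod_dvd !modz_nat.
    rewrite (negPf (contra (eqn_mod_pXW Nv0) jr)).
    symmetry; apply: contraNF jr => /(eqn_mod_pXW Nv0)/eqP ->.
    by rewrite eqn_mod_shift.
  have := modfix_classes_card p3 qU hfix.
  rewrite count_or => [|j j1 j2]; last first.
    have : j == r %[mod 3].
      case/orP: j2 => /(eqn_mod_pXW Nv0) // /eqP ->; by rewrite eqn_mod_shift.
    by move: (eqn_mod_pXW N0 j1) => /eqP ->; case: (r).
  rewrite count_or => [|j /eqP j1 /eqP j2]; last first.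
    case/negP: kv2; apply: (@dvdn_trans (3 ^ (N - v0))); first by rewrite dvdn_exp2l.
    by rewrite -(eqn_mod_shift _ beta r) -j2 j1.
  have vN : (v0 <= N)%N by apply: leq_trans (ltnW hv); rewrite -addnn leq_addr.
  rewrite !count_mod_pX // ?(leqW (leq_subr _ _)) //.
  rewrite subSnn subSn ?leq_subr // subKn // expn1.
  by rewrite addn1 addnn -mul2n addnC.
- have MN1 : ((N.+1./2).*2 <= N.+1)%N by lia.
  have NM : (N <= (N.+1./2).*2)%N by lia.
  have M0 : (0 < N.+1./2)%N by lia.
  have MN : (N.+1./2 <= N)%N by lia.
  have hfix j : ((3 ^ N.+1)%N %| geo (zres q N.+1) j - j%:Z)%Z =
     (j == ~~ r %[mod 3 ^ N]) || (j == r %[mod 3 ^ N.+1./2]).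
    rewrite fixP hP; congr orb.
    have [jr|jr] /= := boolP (j == r %[mod 3]); last first.
      by rewrite (negPf (contra (eqn_mod_pXW M0) jr)).
    have rj := mod_ge_bool p3 (eqP jr).
    rewrite -(subnK rj) eqn_mod_shift in jr *; rewrite eqn_mod_shift.
    apply: hB => // beta b3 hbeta; apply: contraT => hb.
    rewrite -pX_dvdZ in hb; have [d [c [dM ec hc]]] := pX_dvd_exact hb.
    have hd i : (3 ^ i %| (beta + r) * (beta + r).-1)%N = (i <= d)%N.
      by rewrite shift // -pX_dvdZ ec (pX_dvdM p3).
    have vd : vp ((beta + r)%:R * ((beta + r)%:R - 1) : padic 3) = (d%:Z)%:E.
      have pid i : pideal i ((beta + r)%:R * ((beta + r)%:R - 1) : padic 3) <-> (i <= d)%N.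
        by rewrite -hd; exact: (pidealM_nat p3 (leqnn i) (pcong_refl _ _)).
      by apply/vpP; split; [apply/pid | move/pid; rewrite ltnn].
    have d0 : (0 < d)%N by rewrite -hd expn1 -[(beta + r)%N]addn0 addn0 -(expn1 3) shift.
    have : (v0%:Z%:E <= d%:Z%:E :> \bar int)%E.
      rewrite -vd; apply: vmin; split.
        by rewrite vd => -[d0']; rewrite d0' in d0.
      exists (beta + r)%:R => //.
      by apply/(modfix_cong p3 qU (pcong_refl _ _)); rewrite fixP.
    rewrite lee_fin lez_nat => vd'; lia.
  have := modfix_classes_card p3 qU hfix.
  rewrite count_or => [|j j1 j2]; last first.
    move: (eqn_mod_pXW N0 j1) (eqn_mod_pXW M0 j2) => /eqP ->; by case: (r).
  by rewrite !count_mod_pX // ?(leqW MN) // subSnn expn1 addnC divn2.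
Qed.

End SpecialMain.

Unset Implicit Arguments.
Set Strict Implicit.

Theorem corollary5p10 (p : nat) (q : padic p) (n : nat) :
  prime p -> principal_units p 1 q -> (1 <= n)%N ->
  (pcong n q 1 -> forall z : padic p, modfix q n z) /\
  (~ pcong n q 1 ->
   forall m0 : nat, vp (q - 1) = (m0%:Z)%:E ->
   [/\ odd p -> p <> 3%N \/ principal_units p 2 q ->
        modfix_classes q n #= `I_(2 * p ^ m0),
      p = 2%N ->
        modfix_classes q n #= `I_(2 ^ m0) &
      p = 3%N -> (principal_units p 1 `\` principal_units p 2) q ->
        forall v0 : nat, is_least_value q n (v0%:Z)%:E ->
        (v0%:R < (n%:R - 1) / 2 :> rat ->
           modfix_classes q n #= `I_(2 * 3 ^ (v0 + 1) + 3)) /\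
        (v0%:R >= (n%:R - 1) / 2 :> rat ->
           modfix_classes q n #= `I_(3 ^ (n - n %/ 2) + 3))]).
Proof.
move=> pp qU n1; have p0 := prime_gt0 pp; split=> [qn z|qn m0 vq].
  apply/(modfix_cong pp qU (pcong_res p0 n z)); rewrite geo_geo2 addrC addKr.
  by apply: dvdz_mulr; rewrite PoszX; apply/(pcong_one q pp (leqnn n)).
have /andP[m00 m0n] := m0_bounds qU qn vq.
have regular := modfix_classes_card_regular pp qU qn vq.
split=> [podd h3|p2|p3].
- have p2 : (p == 2%N) = false by apply/eqP => p2; rewrite p2 in podd.
  have := regular; rewrite p2 subn0; apply.
  case: h3 => [|/principal_unitsP q2]; [by left | right].
  apply/(pcong_one q pp) => //; rewrite ltnNge; apply/negP => n2; apply: qn.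
  exact: pcongW (leqW n2) q2.
- by subst p; have := regular (or_introl _); rewrite subn1 -expnS prednK //; apply.
case=> _ qU2 v0; move: p3 => p3; subst p.
have m01 : m0 = 1%N.
  apply/eqP; rewrite eqn_leq m00 andbT leqNgt; apply/negP => m02; apply: qU2.
  by apply/principal_unitsP; apply: pcongW m02 _; have [] := (vpP _ _).1 vq.
case: n n1 qn m0n regular => // N _ qn _ _ least; rewrite m01 in vq.
have [hlt hge] := modfix_classes_card_special qU qn vq least.
have e2 : (N.+1%:R - 1) / 2 = N%:R / 2 :> rat by rewrite -natr1 addrK.
rewrite e2 ltr_pdivlMr // ler_pdivrMr // -natrM ltr_nat ler_nat muln2.
by split.
Qed.
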